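(* Let $A=(a_{ij})$ be a real nonsingular $n\times n$ matrix, let $j_1,\ldots,j_s$ be the (distinct) indices of its irregular columns, and let $\tilde A$ be the matrix obtained from $A$ by sparsifying these columns, i.e. by setting some off-diagonal nonzero entries in columns $j_1,\ldots,j_s$ of $A$ to zero, while keeping all diagonal entries and all other entries of $A$ unchanged. Then $\tilde A$ is nonsingular in each of the following cases: (i) $A$ is strictly (row or column) diagonally dominant; (ii) $A$ is irreducibly (row or column) diagonally dominant; (iii) $A$ is an $M$-matrix.
   Context: Splitting: the columns $j_1,\ldots,j_s$ of $A$ are designated as irregular (relatively dense). Each irregular column $a_{j_i}$ is replaced by a sparsified column $\tilde a_{j_i}$, which retains the diagonal entry of $a_{j_i}$ and some of its off-diagonal nonzero entries, the remaining off-diagonal nonzero entries being dropped (replaced by $0$). All other columns are unchanged. The resulting matrix is $\tilde A$. Thus $\tilde a_{ii}=a_{ii}$ for all $i$, and every nonzero off-diagonal entry $\tilde a_{ij}$ equals $a_{ij}$. Definitions. $A$ is strictly row diagonally dominant if $|a_{ii}|>\sum_{j\neq i}|a_{ij}|$ for all $i$. It is irreducibly row diagonally dominant if $A$ is irreducible, $|a_{ii}|\ge\sum_{j\ne i}|a_{ij}|$ for all $i$, and strict inequality holds for at least one $i$. The column versions are the same conditions for $A^T$. $A$ is an $M$-matrix if $a_{ij}\le 0$ for all $i\neq j$, $A$ is nonsingular, and all entries of $A^{-1}$ are nonnegative. *)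

(* Defs.v *)
From HB Require Import structures.
From mathcomp Require Import all_boot all_order all_fingroup all_algebra.
From mathcomp Require Import reals.

Set Implicit Arguments.
Unset Strict Implicit.
Unset Printing Implicit Defensive.

Import Order.TTheory GRing.Theory Num.Theory.
Local Open Scope ring_scope.

Definition strictly_row_dominant (R : realType) (n : nat) (A : 'M[R]_n) : Prop :=
  forall i : 'I_n, \sum_(j < n | j != i) `|A i j| < `|A i i|.

Definition strictly_col_dominant (R : realType) (n : nat) (A : 'M[R]_n) : Prop :=
  strictly_row_dominant A^T.

(* Some P A P^T is block upper triangular with square diagonal blocks of
   sizes k and n - k, both positive.  In particular every 1 x 1 matrix is
   irreducible, including the zero one. *)
Definition reducible (R : realType) (n : nat) (A : 'M[R]_n) : Prop :=
  exists (s : 'S_n) (k : nat), (0 < k < n)%N /\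
    forall i j : 'I_n, (k <= i)%N -> (j < k)%N ->
      (perm_mx s *m A *m (perm_mx s)^T) i j = 0.

Definition irreducible (R : realType) (n : nat) (A : 'M[R]_n) : Prop :=
  ~ reducible A.

Definition irreducibly_row_dominant (R : realType) (n : nat) (A : 'M[R]_n) : Prop :=
  [/\ irreducible A,
      forall i : 'I_n, \sum_(j < n | j != i) `|A i j| <= `|A i i|
    & exists i : 'I_n, \sum_(j < n | j != i) `|A i j| < `|A i i|].

Definition irreducibly_col_dominant (R : realType) (n : nat) (A : 'M[R]_n) : Prop :=
  irreducibly_row_dominant A^T.

Definition M_matrix (R : realType) (n : nat) (A : 'M[R]_n) : Prop :=
  [/\ forall i j : 'I_n, i != j -> A i j <= 0,
      A \in unitmx
    & forall i j : 'I_n, 0 <= invmx A i j].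

(* Which nonzero off-diagonal entries of the columns in J are dropped is
   arbitrary; dropping none, or all, of them is allowed. *)
Definition sparsification (R : realType) (n : nat) (J : seq 'I_n)
    (A At : 'M[R]_n) : Prop :=
  forall i j : 'I_n,
    At i j = A i j \/ [/\ j \in J, i != j, A i j != 0 & At i j = 0].

(* Main.v *)
Require Import Defs.
From mathcomp Require Import all_boot all_order all_fingroup all_algebra.
From mathcomp Require Import reals.

Import Order.TTheory GRing.Theory Num.Theory.
Local Open Scope ring_scope.

(** Write [B] for the sparsified matrix.  It has the diagonal of [A] and its
    entries do not exceed those of [A] in modulus, a condition
    ([dominated_off_diagonal]) that is stable under transposition and under
    column scaling; all three cases follow from it, and column dominance reduces
    to row dominance of the transposes.

    Let [A] be weakly row dominant, let [B x = 0] with [x] nonzero, and let [S]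
    be the set of indices where [|x_i|] attains its maximum [M > 0].  For [i] in
    [S] the chain
    [|a_ii| M = |sum b_ij x_j| <= sum |b_ij| |x_j| <= (sum |a_ij|) M <= |a_ii| M]
    (sums over [j != i]) collapses to equalities: row [i] of [A] is tight, and
    [a_ij] vanishes whenever [j] is outside [S] ([unitmx_no_tight_closed_set]).
    Strict dominance forbids tight rows.  Under irreducible dominance the strict
    row lies outside [S], so [S] is a proper nonempty set that no arc of the
    graph of [A] leaves, and [A] is reducible ([reducible_closed_set]).
    It is the irreducibility of [A] that is used here: [B] itself may well be
    reducible.

    If [A] is an M-matrix, the vector [x] of row sums of its inverse is
    nonnegative and [A x] is the all-ones vector, so scaling the columns of [A]
    by [x] makes it strictly row dominant ([M_matrix_scaled_dominant]).  The
    same scaling of [B] is then invertible, hence so is [B]. *)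

Definition dominated_off_diagonal {R : realType} {n : nat} (A B : 'M[R]_n) :=
  (forall i, B i i = A i i) /\ (forall i j, `|B i j| <= `|A i j|).

Lemma sparsification_dominated {R : realType} {n} {J : seq 'I_n} {A B : 'M[R]_n} :
  sparsification J A B -> dominated_off_diagonal A B.
Proof.
move=> AB; split=> [i | i j].
  by case: (AB i i) => // -[_]; rewrite eqxx.
by case: (AB i j) => [-> // | [_ _ _ ->]]; rewrite normr0.
Qed.

Lemma dominated_off_diagonal_tr {R : realType} {n} {A B : 'M[R]_n} :
  dominated_off_diagonal A B -> dominated_off_diagonal A^T B^T.
Proof. by case=> ABd ABo; split=> [i | i j]; rewrite !mxE. Qed.

Lemma mul_mx_diagE {R : realType} {n} (A : 'M[R]_n) (d : 'rV_n) i j :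
  (A *m diag_mx d) i j = A i j * d 0 j.
Proof. by rewrite mul_mx_diag mxE. Qed.

Lemma dominated_off_diagonal_scale {R : realType} {n} {A B : 'M[R]_n} (d : 'rV_n) :
  dominated_off_diagonal A B ->
  dominated_off_diagonal (A *m diag_mx d) (B *m diag_mx d).
Proof.
case=> ABd ABo; split=> [i | i j]; rewrite !mul_mx_diagE ?ABd //.
by rewrite !normrM ler_wpM2r.
Qed.

(** The obstruction [S] is the set where a kernel vector of [B] has maximal
    modulus; it is phrased on [A] alone, so that dominance hypotheses on [A]
    can refute it. *)
Lemma unitmx_no_tight_closed_set {R : realType} {n} {A B : 'M[R]_n} :
  dominated_off_diagonal A B ->
  (forall i, \sum_(j < n | j != i) `|A i j| <= `|A i i|) ->
  (forall S : {set 'I_n}, S != set0 ->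
     (forall i, i \in S -> \sum_(j < n | j != i) `|A i j| = `|A i i|) ->
     ~ (forall i j, i \in S -> j \notin S -> A i j = 0)) ->
  B \in unitmx.
Proof.
case=> ABd ABo domA noS; rewrite -unitmx_tr unitmxE unitfE.
apply/negP => /det0P[v v0 vB].
have Bv i : \sum_j B i j * v 0 j = 0.
  have /rowP/(_ i) := vB; rewrite !mxE => {2}<-.
  by apply: eq_bigr => j _; rewrite mxE mulrC.
have [i0 vi0] : exists i, v 0 i != 0 by apply/rV0Pn.
pose m := [arg max_(i > i0) `|v 0 i|]%O.
have maxm j : `|v 0 j| <= `|v 0 m|.
  by rewrite /m; case: arg_maxP => // k _ /(_ j isT).
set M := `|v 0 m| in maxm.
have M0 : 0 < M by rewrite (lt_le_trans _ (maxm i0)) ?normr_gt0.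
have le_terms i j : `|B i j| * `|v 0 j| <= `|A i j| * M by rewrite ler_pM.
pose S := [set i | `|v 0 i| == M].
have collapse i : i \in S ->
    `|A i i| * M = \sum_(j | j != i) `|B i j| * `|v 0 j| /\
    \sum_(j | j != i) `|A i j| * M = \sum_(j | j != i) `|B i j| * `|v 0 j|.
  rewrite inE => /eqP viM.
  have low : `|A i i| * M <= \sum_(j | j != i) `|B i j| * `|v 0 j|.
    have := Bv i; rewrite (bigD1 i) //= => /eqP; rewrite addr_eq0 => /eqP Bii.
    rewrite -ABd -viM -normrM Bii normrN.
    rewrite (le_trans (ler_norm_sum _ _ _)) // ler_sum // => j _.
    by rewrite normrM.
  have mid : \sum_(j | j != i) `|B i j| * `|v 0 j|
             <= \sum_(j | j != i) `|A i j| * M by rewrite ler_sum.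
  have up : \sum_(j | j != i) `|A i j| * M <= `|A i i| * M.
    by rewrite -mulr_suml ler_wpM2r ?domA // ltW.
  split; apply: le_anti.
    by rewrite low (le_trans mid up).
  by rewrite mid (le_trans up low).
apply: (noS S).
- by apply/set0Pn; exists m; rewrite inE.
- move=> i /collapse[tight tight']; apply: (mulIf (lt0r_neq0 M0)).
  by rewrite mulr_suml tight.
- move=> i j iS jS.
  have ji : j != i by apply: contraNneq jS => ->.
  (* Equal sums with ordered terms have equal terms. *)
  have [_ eqsum] := collapse i iS.
  have sum0 : \sum_(k | k != i) (`|A i k| * M - `|B i k| * `|v 0 k|) = 0.
    by rewrite big_split /= sumrN eqsum subrr.
  have := psumr_eq0P (fun k _ => _) sum0.
  move=> /(_ _ j ji) /= eqterm.
  have /eqP : `|A i j| * M - `|B i j| * `|v 0 j| = 0.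
    by apply: eqterm => k; rewrite subr_ge0.
  rewrite subr_eq0 => /eqP AM.
  have : `|A i j| * M <= `|A i j| * `|v 0 j| by rewrite AM ler_wpM2r.
  apply: contraTeq => Aij0; rewrite -ltNge ltr_pM2l ?normr_gt0 //.
  by rewrite lt_neqAle maxm andbT; move: jS; rewrite inE.
Qed.

(** Listing the complement of [S] before [S] gives the permutation. *)
Lemma perm_last_block {n} (S : {set 'I_n}) :
  exists s : 'S_n, forall i : 'I_n, (s i \in S) = (#|~: S| <= i)%N.
Proof.
pose t := enum (~: S) ++ enum S.
have sz : size t = n by rewrite size_cat -!cardE addnC cardsC card_ord.
have ut : uniq t.
  rewrite cat_uniq !enum_uniq andbT /=.
  by apply/hasPn => x; rewrite !mem_enum inE negbK.
have injt : injective (fun i : 'I_n => nth i t i).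
  move=> i j /eqP; rewrite (set_nth_default i j) ?sz //.
  by rewrite nth_uniq ?sz // => /eqP/val_inj.
exists (perm injt) => i; rewrite permE nth_cat -cardE ltnNge.
case: leqP => /= le_i.
  have lt_i : (i - #|~: S| < size (enum S))%N.
    by rewrite -cardE ltn_subLR // addnC cardsC card_ord.
  by rewrite -mem_enum mem_nth.
have : nth i (enum (~: S)) i \in enum (~: S) by rewrite mem_nth // -cardE.
by rewrite mem_enum inE => /negbTE.
Qed.

Lemma reducible_closed_set {R : realType} {n} {A : 'M[R]_n} {S : {set 'I_n}} :
  S != set0 -> S != setT ->
  (forall i j, i \in S -> j \notin S -> A i j = 0) -> reducible A.
Proof.
move=> S0 ST SA; have [s sS] := perm_last_block S.
exists s, #|~: S|; split=> [|i j ki jk].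
  have C0 : (0 < #|~: S|)%N.
    by rewrite card_gt0 -(inj_eq (@setC_inj _)) setCK setC0.
  by rewrite C0 -[ltnRHS]card_ord -(cardsC S) -[ltnLHS]add0n ltn_add2r card_gt0.
by rewrite -row_permE tr_perm_mx -col_permE !mxE SA // sS // -ltnNge.
Qed.

Lemma unitmx_strictly_row_dominant {R : realType} {n} {A B : 'M[R]_n} :
  dominated_off_diagonal A B -> strictly_row_dominant A -> B \in unitmx.
Proof.
move=> AB domA; apply: (unitmx_no_tight_closed_set AB) => [i | S].
  exact: ltW.
by case/set0Pn=> i iS /(_ i iS) tight; have := domA i; rewrite tight ltxx.
Qed.

Lemma unitmx_irreducibly_row_dominant {R : realType} {n} {A B : 'M[R]_n} :
  dominated_off_diagonal A B -> irreducibly_row_dominant A -> B \in unitmx.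
Proof.
move=> AB [irrA domA [i0 strict]].
apply: (unitmx_no_tight_closed_set AB) => // S S0 tight closedS.
apply: irrA; apply: (reducible_closed_set S0) closedS.
apply: contraTneq strict => ST.
by rewrite tight ?ltxx // ST inE.
Qed.

Lemma M_matrix_scaled_dominant {R : realType} {n} {A : 'M[R]_n} :
  M_matrix A -> exists d : 'rV_n, strictly_row_dominant (A *m diag_mx d).
Proof.
case=> offA unitA invA0; pose x : 'cV[R]_n := invmx A *m const_mx 1.
have x0 j : 0 <= x j 0.
  by rewrite mxE sumr_ge0 // => k _; rewrite mxE mulr1.
have Ax i : \sum_j A i j * x j 0 = 1.
  have /colP/(_ i) : A *m x = const_mx 1 by rewrite mulKVmx.
  by rewrite !mxE.
clearbody x; exists x^T => i; have := Ax i; rewrite (bigD1 i) //= => Axi.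
have -> : \sum_(j | j != i) `|(A *m diag_mx x^T) i j| = A i i * x i 0 - 1.
  rewrite -Axi opprD addNKr -sumrN; apply: eq_bigr => j ji.
  by rewrite mul_mx_diagE mxE ler0_norm // mulr_le0_ge0 // offA // eq_sym.
by rewrite mul_mx_diagE mxE (lt_le_trans _ (ler_norm _)) // gtrBl.
Qed.

Theorem theorem4p1 (R : realType) (n s : nat) (A At : 'M[R]_n)
    (J : s.-tuple 'I_n)
    (A_nonsingular : A \in unitmx)
    (J_distinct : uniq J)
    (At_sparsified : sparsification J A At) :
  [/\ strictly_row_dominant A \/ strictly_col_dominant A -> At \in unitmx,
      irreducibly_row_dominant A \/ irreducibly_col_dominant A ->
        At \in unitmx
    & M_matrix A -> At \in unitmx].
Proof.
have AB := sparsification_dominated At_sparsified.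
have ABt := dominated_off_diagonal_tr AB.
split=> [[] domA | [] domA | /M_matrix_scaled_dominant[d domAd]].
- exact: unitmx_strictly_row_dominant domA.
- by rewrite -unitmx_tr; apply: unitmx_strictly_row_dominant domA.
- exact: unitmx_irreducibly_row_dominant domA.
- by rewrite -unitmx_tr; apply: unitmx_irreducibly_row_dominant domA.
- have := dominated_off_diagonal_scale d AB.
  move/unitmx_strictly_row_dominant/(_ domAd).
  by rewrite unitmx_mul => /andP[].
Qed.
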